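(* If $X$ is a nonempty finite set of size $n$, then the largest subsemilattices (subsemilattices of maximum cardinality) of $T(X)$ have $2^{n-1}$ elements.
   Context: $T(X)$ is the monoid of full transformations on $X$, i.e. all maps $X\to X$ under composition. A semilattice is a commutative semigroup all of whose elements are idempotent; a subsemilattice of a monoid is a subsemigroup that is a semilattice. *)

(* Defs.v *)
From HB Require Import structures.
From mathcomp Require Import all_boot.

Set Implicit Arguments.
Unset Strict Implicit.
Unset Printing Implicit Defensive.

Import Algebra.

Local Open Scope group_scope.

(* The alias keeps composition apart from the pointwise product that
   {ffun X -> X} inherits when X itself carries a multiplication. *)
Definition transformation (X : finType) : Type := {ffun X -> X}.

HB.instance Definition _ (X : finType) := Finite.on (transformation X).

Section TransformationMonoid.

Variable X : finType.

Definition trans_mul (f g : transformation X) : transformation X :=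
  [ffun x => f (g x)].

Definition trans_one : transformation X := [ffun x => x].

Lemma trans_mulA : associative trans_mul.
Proof. by move=> f g h; apply/ffunP => x; rewrite !ffunE. Qed.

Lemma trans_mul1 : left_id trans_one trans_mul.
Proof. by move=> f; apply/ffunP => x; rewrite !ffunE. Qed.

Lemma trans_mulr1 : right_id trans_one trans_mul.
Proof. by move=> f; apply/ffunP => x; rewrite !ffunE. Qed.

HB.instance Definition _ := isMonoid.Build (transformation X)
  trans_mulA trans_mul1 trans_mulr1.

End TransformationMonoid.

Definition subsemilattice (M : monoidType) (S : {pred M}) : Prop :=
  [/\ mulg_closed S,
      {in S &, forall x y, commute x y} &
      {in S, forall x, x * x = x}].

Definition largest_subsemilattice (X : finType)
    (S : {set transformation X}) : Prop :=
  subsemilattice S /\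
  forall S' : {set transformation X}, subsemilattice S' -> #|S'| <= #|S|.

(* Main.v *)
Require Import Defs.
From mathcomp Require Import all_boot.

(** An idempotent fixes exactly its image, and two commuting idempotents with
    the same fixed points are equal, so a semilattice S embeds in the subsets
    of X by taking fixed points.  If e and f commute, then e (f x) = f (e x) is
    fixed by both, so the fixed point sets pairwise intersect and at most one of
    A and ~: A occurs: #|S| <= 2 ^ (n - 1).  The bound is reached by the
    maps which fix A pointwise and collapse everything else to a base point. *)

Lemma card_intersecting (X : finType) (F : {set {set X}}) :
  {in F &, forall A B, A :&: B != set0} -> #|F|.*2 <= 2 ^ #|X|.
Proof.
move=> intF; have FC: [disjoint F & (@setC X) @: F].
  rewrite disjoint_subset; apply/subsetP => A FA; rewrite inE.
  apply/imsetP => -[B FB eqA].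
  by have := intF A B FA FB; rewrite eqA setIC setICr eqxx.
(* Complementation is injective, so [F] and its disjoint image together make up [#|F|.*2] subsets of
   [X]. *)
rewrite -addnn -{2}(card_imset (mem F) (@setC_inj X)).
move: FC; rewrite -leq_card_setU => /eqP <-.
rewrite -cardsT -card_powerset powersetT; exact: subset_leq_card (subsetT _).
Qed.

Definition fixpoints {X : finType} (f : transformation X) : {set X} :=
  [set x | f x == x].

Section Subsemilattice.

Context {X : finType} {S : {set transformation X}}.
Hypothesis semiS : subsemilattice S.

Lemma subsemilattice_idem f x : f \in S -> f (f x) = f x.
Proof.
by case: semiS => _ _ idS /idS /(congr1 (fun h : {ffun X -> X} => h x)); rewrite ffunE.
Qed.

Lemma subsemilattice_comm f g x : f \in S -> g \in S -> f (g x) = g (f x).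
Proof.
case: semiS => _ cS _ Sf Sg.
by have /(congr1 (fun h : {ffun X -> X} => h x)) := cS f g Sf Sg; rewrite !ffunE.
Qed.

Lemma fixpoints_inj : {in S &, injective fixpoints}.
Proof.
move=> f g Sf Sg eqfg; apply/ffunP => x.
(* The chain is [f x = g (f x) = f (g x) = g x]: the values of each map are fixed by the other. *)
have /eqP <-: g (f x) == f x.
  have: f x \in fixpoints f by rewrite inE subsemilattice_idem.
  by rewrite eqfg inE.
rewrite -subsemilattice_comm //; apply/eqP.
have: g x \in fixpoints g by rewrite inE subsemilattice_idem.
by rewrite -eqfg inE.
Qed.

Lemma card_subsemilattice (x : X) : #|S| <= 2 ^ #|X|.-1.
Proof.
rewrite -leq_double -(card_in_imset fixpoints_inj).
(* Nonemptiness makes the predecessor exact, so the doubled bound is [2 ^ #|X|]. *)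
have X_gt0: 0 < #|X| by apply/card_gt0P; exists x.
have <-: 2 ^ #|X| = (2 ^ #|X|.-1).*2 by rewrite -mul2n -expnS prednK.
apply: card_intersecting => _ _ /imsetP[f Sf ->] /imsetP[g Sg ->].
apply/set0Pn; exists (f (g x)); rewrite !inE subsemilattice_idem // eqxx /=.
by rewrite subsemilattice_comm // subsemilattice_idem.
Qed.

End Subsemilattice.

Section Collapse.

Context {X : finType}.
Variable x0 : X.

Definition collapse (A : {set X}) : transformation X :=
  [ffun x => if x \in A then x else x0].

(** [A] and [x0 |: A] collapse alike; subsets avoiding [x0] index each map once. *)
Definition collapses : {set transformation X} :=
  collapse @: powerset [set~ x0].

Lemma collapseM A B : (collapse A * collapse B)%g = collapse (A :&: B).
Proof.
apply/ffunP => x; rewrite !ffunE inE andbC.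
(* A point outside [B] goes to [x0], which [collapse A] fixes whether or not [x0] is in [A]. *)
by case: (x \in B) => //=; case: ifP.
Qed.

Lemma collapses_subsemilattice : subsemilattice collapses.
Proof.
split.
- move=> _ _ /imsetP[A sA ->] /imsetP[B sB ->]; rewrite collapseM imset_f //.
  by move: sA; rewrite !powersetE; apply: subset_trans; apply: subsetIl.
- move=> _ _ /imsetP[A sA ->] /imsetP[B sB ->].
  by rewrite /commute !collapseM setIC.
- by move=> _ /imsetP[A sA ->]; rewrite collapseM setIid.
Qed.

Lemma card_collapses : #|collapses| = 2 ^ #|X|.-1.
Proof.
rewrite card_in_imset ?card_powerset ?cardsC1 // => A B.
rewrite !powersetE !(subsetC _ [set x0]) !sub1set !inE => A'x0 B'x0 /ffunP eqAB.
apply/setP => x; have := eqAB x; rewrite !ffunE.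
(* Both sets omit [x0]; any other point lies in [A] exactly when [collapse A] fixes it. *)
have [->|/eqP ne_x] := eqVneq x x0; first by rewrite (negPf A'x0) (negPf B'x0).
by do 2 case: (x \in _) => //; move=> eqx; case: ne_x.
Qed.

End Collapse.

Theorem corollary1p3 (X : finType) (n : nat) (n_gt0 : 0 < n) (cardX : #|X| = n) :
  (exists S : {set transformation X}, largest_subsemilattice S) /\
  (forall S : {set transformation X},
     largest_subsemilattice S -> #|S| = 2 ^ n.-1).
Proof.
have /card_gt0P[x0 _]: 0 < #|X| by rewrite cardX.
rewrite -cardX; split.
  exists (collapses x0); split; first exact: collapses_subsemilattice.
  by move=> S semiS; rewrite card_collapses card_subsemilattice.
move=> S [semiS maxS]; apply/eqP; rewrite eqn_leq card_subsemilattice //=.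
(* Maximality against [collapses x0] gives the lower bound. *)
by rewrite -(card_collapses x0) maxS //; apply: collapses_subsemilattice.
Qed.
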